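(* Let $f:\mathbb{R}^n\to\mathbb{R}$ be convex, and suppose that there exists a number $\alpha$ such that the set $E_\alpha=\{x\in\mathbb{R}^n : f(x)\le\alpha\}$ is non-empty and bounded. Let $X^*$ be the set of minimizers of $f$ over $\mathbb{R}^n$ and let $f^*$ be the minimal value. Let $x^0\in\mathbb{R}^n$, let $x^*\in X^*$ be arbitrary, let $\rho'$ be the radius of the smallest closed ball centered at $x^*$ that contains $E_{\alpha'}$, where $\alpha'=f(x^0)$, and let $\mu'$ be a number such that $E_{\mu'}\supset B(x^*,\rho')$. Let $\{x^k\}$ be any sequence generated by Method (CSGM) (described in the context) started at $x^0$ with parameter $\mu\ge\mu'$. Then: (i) The sequence $\{x^k\}$ has a limit point which belongs to $X^*$. (ii) $\lim_{k\to\infty}\varphi_k=f^*$, where $\varphi_k=\min_{0\le i\le k} f(x^i)$.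
   Context: Notation. $\mathbb{R}^n$ carries the Euclidean inner product $\langle\cdot,\cdot\rangle$ and norm $\|\cdot\|$. $B(x,\varepsilon)=\{y\in\mathbb{R}^n : \|y-x\|\le\varepsilon\}$. For any number $\alpha$, $E_\alpha=\{x\in\mathbb{R}^n : f(x)\le\alpha\}$. The subdifferential of $f$ at $x$ is $\partial f(x)=\{g\in\mathbb{R}^n : f(y)-f(x)\ge\langle g,y-x\rangle\ \ \forall y\in\mathbb{R}^n\}$. $\mathrm{conv}\,X$ is the convex hull of a set $X$, and $\mathrm{Nr}\,X$ is the element of $X$ nearest to the origin. A limit point of a sequence is a limit of some subsequence. Method (CSGM). The method never stops. The assignments in each step are executed in the order written, with the current values of the counters $k,l,m,s,t$ and of the variable $b$. Whenever an element of a subdifferential is computed or taken, it is one arbitrary element. Step 0: Choose a point $x^0$, numbers $\mu$ and $\theta\in(0,1)$, and sequences $\{\alpha_s\},\{\beta_m\},\{\eta_t\},\{d_t\}$ (indexed by $0,1,2,\dots$) such that $\alpha_s\in(0,1)$, $\alpha_s\to0$; $\beta_m>0$, $\beta_m\to0$, $\sum_{m=0}^\infty\beta_m=\infty$; $\eta_t>0$, $\eta_t\to0$; $d_t>0$, $d_t\to0$. Set $k:=0$, $l:=0$, $m:=0$, $s:=0$, $t:=0$, $b:=0$, $\lambda_0:=\beta_0$, $y^0:=x^0$. Compute $g^0\in\partial f(x^0)$, set $u^0:=x^0$, $p^0:=g^0$. Step 1 (norm restart): If $\|p^k\|\le\eta_t$, set $p^k:=g^k$, $l:=l+1$, $t:=t+1$,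 $b:=0$. (In either case continue to Step 2.) Step 2: Set $y^{k+1}:=x^k-\lambda_kp^k$, $b:=b+\lambda_k\|p^k\|$, compute $g^{k+1}\in\partial f(y^{k+1})$. If $f(y^{k+1})\le f(x^k)-\theta\lambda_k\|p^k\|^2$, set $x^{k+1}:=y^{k+1}$, $\lambda_{k+1}:=\lambda_k$ and go to Step 4 (descent step). Otherwise go to Step 3. Step 3: Set $\lambda_{k+1}:=\alpha_s\beta_m$, $s:=s+1$. If $f(y^{k+1})\le\mu$, set $x^{k+1}:=y^{k+1}$ and go to Step 4. Otherwise (function value restart) take $p^{k+1}:=g^{k+1}\in\partial f(u^k)$, set $x^{k+1}:=u^k$, $u^{k+1}:=u^k$, $m:=m+1$, $\lambda_{k+1}:=\beta_m$, $k:=k+1$, $t:=t+1$, $s:=0$, $b:=0$ and go to Step 1. Step 4: If $f(x^{k+1})<f(u^k)$, set $u^{k+1}:=x^{k+1}$; otherwise set $u^{k+1}:=u^k$. If $b>d_t$ (distance restart), take $p^{k+1}:=g^{k+1}\in\partial f(x^{k+1})$, set $m:=m+1$, $\lambda_{k+1}:=\beta_m$, $k:=k+1$, $t:=t+1$, $s:=0$, $b:=0$ and go to Step 1. Otherwise go to Step 5. Step 5: Set $p^{k+1}:=\mathrm{Nr}\,\mathrm{conv}\{p^k,g^{k+1}\}$, $k:=k+1$ and go to Step 1. *)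

(* Defs.v *)
From HB Require Import structures.
From mathcomp Require Import all_boot all_order all_algebra.
From mathcomp Require Import all_classical all_reals all_analysis.

Set Implicit Arguments.
Unset Strict Implicit.
Unset Printing Implicit Defensive.

Import Order.TTheory GRing.Theory Num.Theory.
Import numFieldNormedType.Exports.
Local Open Scope classical_set_scope.
Local Open Scope ring_scope.

(* The library norm `|x| on 'rV[R]_n is the sup norm. It is used only through
   the topology and the bounded sets it induces, which are the Euclidean ones;
   every quantitative use of a norm goes through [enorm]. *)
Definition dot (R : realType) (n : nat) (x y : 'rV[R]_n) : R :=
  \sum_(i < n) x ord0 i * y ord0 i.

Definition enorm (R : realType) (n : nat) (x : 'rV[R]_n) : R :=
  Num.sqrt (dot x x).

Definition ecball (R : realType) (n : nat) : 'rV[R]_n -> R -> set 'rV[R]_n :=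
  closed_ball_ (@enorm R n).

Definition least (R : realType) (A : set R) (a : R) : Prop :=
  A a /\ lbound A a.

Definition level_set (R : realType) (n : nat) (f : 'rV[R]_n -> R) (a : R) :
  set 'rV[R]_n := [set x | f x <= a].

Definition minimizers (R : realType) (n : nat) (f : 'rV[R]_n -> R) :
  set 'rV[R]_n := [set x | forall y, f x <= f y].

Definition subdifferential (R : realType) (n : nat) (f : 'rV[R]_n -> R)
    (x : 'rV[R]_n) : set 'rV[R]_n :=
  [set g | forall y, dot g (y - x) <= f y - f x].

Definition conv_hull (R : realType) (n : nat) (X : set 'rV[R]_n) :
  set 'rV[R]_n := smallest (@convex_set R 'rV[R]_n) X.

(* [Nr X z]: z is an element of X nearest to the origin; it is unique when X is
   convex. *)
Definition Nr (R : realType) (n : nat) (X : set 'rV[R]_n) : set 'rV[R]_n :=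
  [set z | X z /\ forall w, X w -> enorm z <= enorm w].

Definition subseq_limit (R : realType) (n : nat) (x : nat -> 'rV[R]_n)
    (a : 'rV[R]_n) : Prop :=
  exists2 sigma : nat -> nat, increasing_seq sigma & x \o sigma @ \oo --> a.

Record csgm_params (R : realType) := CsgmParams {
  par_mu : R;
  par_theta : R;
  par_alpha : nat -> R;
  par_beta : nat -> R;
  par_eta : nat -> R;
  par_d : nat -> R }.

Record csgm_admissible (R : realType) (P : csgm_params R) : Prop :=
  CsgmAdmissible {
  theta_itv : 0 < par_theta P < 1;
  alpha_itv : forall i, 0 < par_alpha P i < 1;
  alpha_cvg : par_alpha P @ \oo --> 0;
  beta_gt0 : forall i, 0 < par_beta P i;
  beta_cvg : par_beta P @ \oo --> 0;
  beta_dvg : series (par_beta P) @ \oo --> +oo;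
  eta_gt0 : forall i, 0 < par_eta P i;
  eta_cvg : par_eta P @ \oo --> 0;
  d_gt0 : forall i, 0 < par_d P i;
  d_cvg : par_d P @ \oo --> 0 }.

(* The data on entry to [csgm_step1] with iteration counter k: x^k, y^k, u^k, p^k,
   g^k, lambda_k, and the current values of b, l, m, s, t. The counter k is
   the index in the sequence of states; every pass through the steps increases
   it exactly once. *)
Record csgm_state (R : realType) (n : nat) := CsgmState {
  st_x : 'rV[R]_n;
  st_y : 'rV[R]_n;
  st_u : 'rV[R]_n;
  st_p : 'rV[R]_n;
  st_g : 'rV[R]_n;
  st_lam : R;
  st_b : R;
  st_l : nat;
  st_m : nat;
  st_s : nat;
  st_t : nat }.

Section Method.
Variables (R : realType) (n : nat) (f : 'rV[R]_n -> R) (P : csgm_params R).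
Implicit Types (w : csgm_state R n) (x y g u : 'rV[R]_n) (lam b : R).

Definition csgm_step0 (x0 : 'rV[R]_n) w : Prop :=
  exists2 g0, subdifferential f x0 g0 &
    w = {| st_x := x0; st_y := x0; st_u := x0; st_p := g0; st_g := g0;
           st_lam := par_beta P 0; st_b := 0;
           st_l := 0; st_m := 0; st_s := 0; st_t := 0 |}.

Definition csgm_step1 w : csgm_state R n :=
  if enorm (st_p w) <= par_eta P (st_t w) then
    {| st_x := st_x w; st_y := st_y w; st_u := st_u w;
       st_p := st_g w; st_g := st_g w;
       st_lam := st_lam w; st_b := 0;
       st_l := (st_l w).+1; st_m := st_m w; st_s := st_s w;
       st_t := (st_t w).+1 |}
  else w.

(* Below, w is the state returned by [csgm_step1], whose vectors and step size carry
   the index k; y, x, g, lam, u are y^(k+1), x^(k+1), g^(k+1), lambda_(k+1),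
   u^(k+1); b and s are the current values, which may differ from those in w;
   w' is the state on the next entry to [csgm_step1]. *)
Definition csgm_step5 w y x g u lam b (s : nat) (w' : csgm_state R n) : Prop :=
  exists2 p, Nr (conv_hull [set st_p w; g]) p &
    w' = {| st_x := x; st_y := y; st_u := u; st_p := p; st_g := g;
            st_lam := lam; st_b := b;
            st_l := st_l w; st_m := st_m w; st_s := s; st_t := st_t w |}.

Definition csgm_step4 w y x g lam b (s : nat) (w' : csgm_state R n) : Prop :=
  let u := if f x < f (st_u w) then x else st_u w in
  if par_d P (st_t w) < b then
    exists2 g', subdifferential f x g' &
      w' = {| st_x := x; st_y := y; st_u := u; st_p := g'; st_g := g';
              st_lam := par_beta P (st_m w).+1; st_b := 0;
              st_l := st_l w; st_m := (st_m w).+1; st_s := 0;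
              st_t := (st_t w).+1 |}
  else csgm_step5 w y x g u lam b s w'.

Definition csgm_step3 w y g b (w' : csgm_state R n) : Prop :=
  let lam := par_alpha P (st_s w) * par_beta P (st_m w) in
  if f y <= par_mu P then csgm_step4 w y y g lam b (st_s w).+1 w'
  else
    exists2 g', subdifferential f (st_u w) g' &
      w' = {| st_x := st_u w; st_y := y; st_u := st_u w;
              st_p := g'; st_g := g';
              st_lam := par_beta P (st_m w).+1; st_b := 0;
              st_l := st_l w; st_m := (st_m w).+1; st_s := 0;
              st_t := (st_t w).+1 |}.

Definition csgm_step2 w (w' : csgm_state R n) : Prop :=
  let y := st_x w - st_lam w *: st_p w in
  let b := st_b w + st_lam w * enorm (st_p w) in
  exists2 g, subdifferential f y g &
    if f y <= f (st_x w) - par_theta P * st_lam w * enorm (st_p w) ^+ 2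
    then csgm_step4 w y y g (st_lam w) b (st_s w) w'
    else csgm_step3 w y g b w'.

Definition csgm_sequence (x0 : 'rV[R]_n) (xs : nat -> 'rV[R]_n) : Prop :=
  exists w : nat -> csgm_state R n,
    [/\ csgm_step0 x0 (w 0%N),
        forall k, csgm_step2 (csgm_step1 (w k)) (w k.+1) &
        forall k, xs k = st_x (w k)].

End Method.

(* Main.v *)
Require Import Defs.
From HB Require Import structures.
From mathcomp Require Import all_boot all_order all_algebra.
From mathcomp Require Import all_classical all_reals all_analysis.
From mathcomp Require Import ring lra.

Import Order.TTheory GRing.Theory Num.Theory.
Import numFieldNormedType.Exports.
Local Open Scope classical_set_scope.
Local Open Scope ring_scope.

Set Implicit Arguments.
Unset Strict Implicit.
Unset Printing Implicit Defensive.

(** Let f* be the minimum. Both claims follow from liminf f(x^k) = f*: all x^k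
lie in the level set of max(f(x^0), mu), which is bounded because one nonempty
level set is ([level_sets_bounded]), and f is continuous
([convex_continuous]), so a subsequence along which f tends to f* has a limit
point, which is a minimizer ([minimizing_subseq]).

Suppose then that f(x^k) >= f* + e from some iteration on. As long as no
restart occurs, the direction p^k is a convex combination of subgradients taken
at iterates of the current cycle, all within the path length b of x^k.
Averaging their subgradient inequalities gives [aggregate]:
  f(z) >= f* + e + <p^k, z - x^k> - C b   for all z,
where C bounds the subgradients and b <= d_t. Four consequences are drawn.

- A cycle cannot last forever ([restarts_forever]). Replacing p^k by the point
  of [p^k, g^(k+1)] nearest to 0 after a null step decreases |p^k|^2 by a fixed
  amount as long as |p^k| > eta_t ([Nr_decrease]), so null steps are finitely
  many; the step size is then constant and b outgrows d_t.

- Since eta_t and d_t tend to 0, the inequality at z = x* eventually excludes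
  |p^k| <= eta_t ([no_norm_restart]). Hence m tends to infinity and all step
  sizes tend to 0.

- The inequality at z = x* also reads <p^k, x^k - x*> >= e/2, so a short step
  decreases the squared distance to x* by at least lambda_k e/2
  ([trial_closer]). After a value restart x^k is in the level set of x^0, hence
  in the ball B(x*, rho'); trial points then never leave this ball, where
  f <= mu, so there is no further value restart
  ([eventually_no_value_restart]).

- Consequently lambda_0 + lambda_1 + ... converges. But every restart resets
  the step size to the next beta_m, and the sum of the beta_m diverges
  ([run_small_values]). *)

(** * The Euclidean inner product *)

Section Euclidean.
Context {R : realType} {n : nat}.
Implicit Types (a b x y z : 'rV[R]_n) (c : R).

Lemma dotC x y : dot x y = dot y x.
Proof. by apply: eq_bigr => i _; rewrite mulrC. Qed.

Lemma dotDl x y z : dot (x + y) z = dot x z + dot y z.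
Proof. by rewrite -big_split; apply: eq_bigr => i _; rewrite mxE mulrDl. Qed.

Lemma dotZl c x y : dot (c *: x) y = c * dot x y.
Proof. by rewrite mulr_sumr; apply: eq_bigr => i _; rewrite mxE mulrA. Qed.

Lemma dotNl x y : dot (- x) y = - dot x y.
Proof. by rewrite -scaleN1r dotZl mulN1r. Qed.

Lemma dotDr x y z : dot z (x + y) = dot z x + dot z y.
Proof. by rewrite dotC dotDl !(dotC z). Qed.

Lemma dotNr x y : dot y (- x) = - dot y x.
Proof. by rewrite dotC dotNl dotC. Qed.

Lemma dotZr c x y : dot y (c *: x) = c * dot y x.
Proof. by rewrite dotC dotZl dotC. Qed.

Definition dotE := (dotDl, dotDr, dotNl, dotNr, dotZl, dotZr).

Lemma dot_ge0 x : 0 <= dot x x.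
Proof. by apply: sumr_ge0 => i _; rewrite -expr2 sqr_ge0. Qed.

Lemma enorm_ge0 x : 0 <= enorm x.
Proof. exact: sqrtr_ge0. Qed.

Lemma sqr_enorm x : enorm x ^+ 2 = dot x x.
Proof. by rewrite sqr_sqrtr ?dot_ge0. Qed.

Lemma enorm_eq0 x : (enorm x == 0) = (x == 0).
Proof.
apply/eqP/eqP => [x0|->]; last first.
  by rewrite /enorm -(scale0r 0) dotZl mul0r sqrtr0.
apply/rowP => i; rewrite mxE; apply/eqP; rewrite -sqrf_eq0 expr2.
have /eqP : dot x x = 0 by rewrite -sqr_enorm x0 expr0n.
rewrite psumr_eq0 => [/allP/(_ i)|j _]; last by rewrite -expr2 sqr_ge0.
by rewrite mem_index_enum => /(_ isT).
Qed.

Lemma enormB x y : enorm (x - y) = enorm (y - x).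
Proof. by rewrite /enorm -(opprB y) dotNl dotNr opprK. Qed.

(** Cauchy-Schwarz, from the nonnegativity of the square of |y| x - |x| y. *)
Lemma dot_le_enormM x y : dot x y <= enorm x * enorm y.
Proof.
have [/eqP|x0] := eqVneq (enorm x) 0.
  rewrite enorm_eq0 => /eqP ->.
  by rewrite -(scale0r 0) dotZl mul0r mulr_ge0 ?enorm_ge0.
have [/eqP|y0] := eqVneq (enorm y) 0.
  rewrite enorm_eq0 => /eqP ->.
  by rewrite -(scale0r 0) dotZr mul0r mulr_ge0 ?enorm_ge0.
have xy_gt0 : 0 < enorm x * enorm y.
  by rewrite mulr_gt0 // lt_neqAle eq_sym enorm_ge0 andbT.
have := dot_ge0 (enorm y *: x - enorm x *: y).
rewrite !dotE (dotC y x) -!sqr_enorm => H.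
by rewrite -(ler_pM2l xy_gt0); nra.
Qed.

Lemma normr_le_enorm x : `|x| <= enorm x.
Proof.
rewrite [leLHS]/Num.norm /= mx_normrE.
apply/bigmax_leP; split => /= [|[i j] _ /=].
  exact: enorm_ge0.
rewrite -(@ler_pXn2r _ 2) ?nnegrE ?enorm_ge0 // sqr_enorm real_normK ?num_real //.
rewrite [i]ord1 /dot (bigD1 j) //= -expr2 lerDl.
by apply: sumr_ge0 => k _; rewrite -expr2 sqr_ge0.
Qed.

Lemma coord_le_normr x i : `|x ord0 i| <= `|x|.
Proof.
rewrite [leRHS]/Num.norm /= mx_normrE.
by apply/bigmax_geP; right => /=; exists (ord0, i).
Qed.

Lemma enorm_le_normr x : enorm x <= Num.sqrt n%:R * `|x|.
Proof.
rewrite -(@ler_pXn2r _ 2) ?nnegrE ?enorm_ge0 ?mulr_ge0 ?sqrtr_ge0 //.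
rewrite sqr_enorm exprMn sqr_sqrtr ?ler0n // /dot.
apply: le_trans (_ : \sum_(i < n) `|x| ^+ 2 <= _).
  apply: ler_sum => i _; rewrite -expr2 -real_normK ?num_real //.
  by rewrite ler_pXn2r ?nnegrE // coord_le_normr.
by rewrite sumr_const card_ord mulr_natl.
Qed.

(** Half-spaces are convex, so an affine inequality valid at two points passes
to their hull. *)
Lemma conv_hull_dot_le a c x y z :
  dot x a <= c -> dot y a <= c -> conv_hull [set x; y] z -> dot z a <= c.
Proof.
move=> xc yc /(_ [set q | dot q a <= c]); apply; split => [u v t|u].
  rewrite !inE /= => uc vc; rewrite !dotE.
  have t0 : 0 <= t%:num by [].
  have t1 : t%:num <= 1 by [].
  by rewrite /= /unstable.onem; nra.
by case=> ->.
Qed.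

Lemma conv_hull_segment x y t : 0 <= t -> t <= 1 ->
  conv_hull [set x; y] (t *: y + (1 - t) *: x).
Proof.
move=> t0 t1 A [cA xyA].
have := cA y x (Itv01 t0 t1); rewrite !inE; apply; apply: xyA; by [left|right].
Qed.

(** Moving from p towards g by a fraction t changes |p|^2 by
-2 t (|p|^2 - <g, p>) + t^2 |g - p|^2, which is at most
-2 t (1 - th) |p|^2 + t^2 (2 C)^2; the decrease is the value for the best t. *)
Lemma Nr_decrease (p g q : 'rV[R]_n) (th C : R) :
  0 < th < 1 -> 0 < C -> enorm p <= C -> enorm g <= C ->
  dot g p <= th * enorm p ^+ 2 -> Nr (conv_hull [set p; g]) q ->
  enorm q ^+ 2 <= enorm p ^+ 2 - ((1 - th) / (2 * C)) ^+ 2 * (enorm p ^+ 2) ^+ 2.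
Proof.
move=> /andP[th0 th1] C0 pC gC gp [_ qmin].
have C1 := ltW C0.
have pC2 : enorm p ^+ 2 <= C ^+ 2 by rewrite ler_pXn2r ?nnegrE ?enorm_ge0.
have gC2 : enorm g ^+ 2 <= C ^+ 2 by rewrite ler_pXn2r ?nnegrE ?enorm_ge0.
have P0 : 0 <= enorm p ^+ 2 by rewrite sqr_ge0.
move: gp pC2 gC2 P0; rewrite !sqr_enorm.
set G := dot g p; set pp := dot p p; set gg := dot g g => gp pC2 gC2 P0.
set t : R := (1 - th) * pp / (4 * C ^+ 2).
have C20 : 0 < C ^+ 2 by rewrite exprn_gt0.
have tE : t * (4 * C ^+ 2) = (1 - th) * pp.
  by rewrite /t mulfVK // gt_eqF ?mulr_gt0.
have t0 : 0 <= t by rewrite /t divr_ge0 // mulr_ge0 //; lra.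
have t1 : t <= 1 by rewrite /t ler_pdivrMr ?mulr_gt0 //; nra.
have /qmin := conv_hull_segment (x := p) (y := g) t0 t1.
rewrite -(@ler_pXn2r _ 2) ?nnegrE ?enorm_ge0 // !sqr_enorm => /le_trans -> //.
rewrite !dotE (dotC p g) -/G -/pp -/gg.
have -> : ((1 - th) / (2 * C)) ^+ 2 * pp ^+ 2 = t * ((1 - th) * pp).
  by rewrite /t; field; rewrite gt_eqF.
have cross : gg - 2 * G + pp <= 4 * C ^+ 2.
  have := dot_ge0 (g + p); rewrite !dotE (dotC p g) -/G -/pp -/gg; nra.
have : t * (t * (gg - 2 * G + pp)) <= t * ((1 - th) * pp).
  by rewrite ler_wpM2l // -tE ler_wpM2l.
have : t * G <= t * (th * pp) by rewrite ler_wpM2l.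
nra.
Qed.

End Euclidean.

(** * Convex functions on row vectors *)

Section Convex.
Context {R : realType} {n : nat} (f : 'rV[R]_n -> R).
Hypothesis f_convex : convex_function [set: 'rV[R]_n] f.
Implicit Types (x y z : 'rV[R]_n).

Lemma convex_comb x y t : 0 <= t -> t <= 1 ->
  f (t *: x + (1 - t) *: y) <= t * f x + (1 - t) * f y.
Proof.
by move=> t0 t1; have := f_convex (Itv01 t0 t1) (in_setT x) (in_setT y).
Qed.

(** By induction on the support: a vector is the midpoint of twice its i-th
component, which lies on a segment whose end points bound f, and of twice the
remaining part, whose support is smaller. *)
Lemma convex_bounded_above (r : R) :
  exists B, forall x, `|x| <= r -> f x <= B.
Proof.
suff : forall (s : seq 'I_n) r, exists B, forall x,
    (forall i, `|x ord0 i| <= r) -> (forall i, i \notin s -> x ord0 i = 0) ->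
    f x <= B.
  move=> /(_ (enum 'I_n) r)[B HB]; exists B => x xr; apply: HB => i.
    exact: le_trans (coord_le_normr x i) xr.
  by rewrite mem_enum.
elim=> [|i s IHs] {}r.
  exists (f 0) => x _ x0; rewrite (_ : x = 0) //.
  by apply/rowP => i; rewrite mxE x0.
have [B HB] := IHs (2 * r).
pose e : 'rV[R]_n := delta_mx ord0 i.
exists (2^-1 * Num.max (f ((2 * r) *: e)) (f (- (2 * r) *: e)) + 2^-1 * B).
move=> x xr x0.
have r0 : 0 <= r by apply: le_trans (xr i).
pose y : 'rV[R]_n := \row_j if j == i then 0 else 2 * x ord0 j.
have xE : x = 2^-1 *: ((2 * x ord0 i) *: e) + (1 - 2^-1) *: y.
  apply/rowP => j; rewrite !mxE eqxx /= eq_sym.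
  by case: eqP => [->|_] /=; field.
have half0 : 0 <= 2^-1 :> R by rewrite invr_ge0.
have half1 : 2^-1 <= 1 :> R by lra.
rewrite {1}xE; apply: le_trans (convex_comb _ _ half0 half1) _.
rewrite (_ : 1 - 2^-1 = 2^-1 :> R); last by field.
apply: lerD; apply: ler_wpM2l => //; last first.
  apply: HB => j; rewrite !mxE.
    case: eqP => [_|_]; first by rewrite normr0 mulr_ge0.
    by rewrite normrM ger0_norm // ler_pM2l.
  move=> js; case: eqVneq => // ji.
  by rewrite x0 ?mulr0 // inE negb_or ji.
have [r_eq0|r_neq0] := eqVneq r 0.
  have -> : x ord0 i = 0.
    by apply/eqP; rewrite -normr_le0; have := xr i; rewrite r_eq0.
  by rewrite r_eq0 mulr0 oppr0 maxxx.
have r_gt0 : 0 < r by rewrite lt_neqAle eq_sym r_neq0.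
pose t := (x ord0 i + r) / (2 * r).
have /andP[xl xu] : (- r <= x ord0 i <= r) by rewrite -ler_norml.
have t0 : 0 <= t by rewrite divr_ge0 //; lra.
have t1 : t <= 1 by rewrite ler_pdivrMr; lra.
have -> : (2 * x ord0 i) *: e
    = t *: ((2 * r) *: e) + (1 - t) *: (- (2 * r) *: e).
  rewrite !scalerA -scalerDl; congr (_ *: _).
  by rewrite /t; field.
apply: le_trans (convex_comb _ _ t0 t1) _.
set M := Num.max _ _.
have M1 : f ((2 * r) *: e) <= M by rewrite le_max lexx.
have M2 : f (- (2 * r) *: e) <= M by rewrite le_max lexx orbT.
have : t * f ((2 * r) *: e) <= t * M by rewrite ler_wpM2l.
have : (1 - t) * f (- (2 * r) *: e) <= (1 - t) * M by rewrite ler_wpM2l ?subr_ge0.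
lra.
Qed.

(** An upper bound B of f on the unit ball around x gives a Lipschitz estimate
at x: convexity on the segment from x to x + u bounds f (x + h) from above, and
convexity on the segment from x + h to x - u, which contains x, bounds it from
below. *)
Lemma convex_continuous : continuous f.
Proof.
move=> x.
have [B HB] := convex_bounded_above (`|x| + 1).
have HBu u : `|u| <= 1 -> f (x + u) <= B.
  by move=> u1; apply: HB; apply: le_trans (ler_normD _ _) _; rewrite lerD2l.
have Bx : 0 <= B - f x.
  by rewrite subr_ge0 -[x in f x]addr0 HBu // normr0 ler01.
have lip h : `|h| <= 1 -> `|f x - f (x + h)| <= `|h| * (B - f x).
  move=> h1; have [->|h0] := eqVneq h 0.
    by rewrite addr0 subrr !normr0 mul0r.
  have d0 : 0 < `|h| by rewrite normr_gt0.
  pose u := `|h|^-1 *: h.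
  have u1 : `|u| = 1 by rewrite normrZ normfV normr_id mulVf // gt_eqF.
  have hE : h = `|h| *: u by rewrite scalerA divff ?scale1r // gt_eqF.
  have up : f (x + h) <= `|h| * B + (1 - `|h|) * f x.
    have -> : x + h = `|h| *: (x + u) + (1 - `|h|) *: x.
      rewrite scalerDr -hE scalerBl scale1r (addrC (_ *: x)).
      by rewrite -addrA subrKC addrC.
    apply: le_trans (convex_comb _ _ (ltW d0) h1) _.
    by rewrite lerD2r ler_pM2l // HBu ?u1.
  pose t := (1 + `|h|)^-1.
  have t0 : 0 < t by rewrite invr_gt0; lra.
  have t1 : t <= 1 by rewrite invf_le1; lra.
  have tE : t * (1 + `|h|) = 1 by rewrite mulVf // gt_eqF //; lra.
  have dn : f x <= t * f (x + h) + (1 - t) * f (x - u).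
    have xE : x = t *: (x + h) + (1 - t) *: (x - u).
      have -> : 1 - t = t * `|h| by rewrite -tE; ring.
      rewrite -scalerA -scalerDr scalerBr -hE addrACA subrr addr0.
      by rewrite -{2}[x]scale1r -scalerDl scalerA tE scale1r.
    by rewrite {1}xE; exact: convex_comb (ltW t0) t1.
  have xuB : f (x - u) <= B by rewrite HBu // normrN u1.
  have dn' : (1 + `|h|) * f x <= f (x + h) + `|h| * B.
    rewrite -(ler_pM2l t0) mulrA tE mul1r; apply: le_trans dn _.
    rewrite mulrDr lerD2l mulrA (_ : t * `|h| = 1 - t); last by rewrite -tE; ring.
    by rewrite ler_wpM2l // subr_ge0.
  by rewrite ler_norml; apply/andP; split; lra.
apply/(@cvgrPdist_lt _ _ _ (nbhs x) _ f (f x)) => e e0.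
pose d := Num.min 1 (e / (B - f x + 1)).
have d0 : 0 < d by rewrite lt_min ltr01 divr_gt0 //; lra.
apply/(@nbhs_normP R _ x); exists d => //= y.
rewrite /ball_ /= distrC /d lt_min => /andP[y1 ye].
have -> : y = x + (y - x) by rewrite addrC subrK.
apply: le_lt_trans (lip _ (ltW y1)) _.
move: ye; rewrite ltr_pdivlMr; last by lra.
by have := normr_ge0 (y - x); nra.
Qed.

End Convex.

(** * Level sets and minimizing sequences *)

Section Minimizing.
Context {R : realType} {n : nat} (f : 'rV[R]_n -> R) (xstar : 'rV[R]_n).
Hypothesis f_convex : convex_function [set: 'rV[R]_n] f.
Hypothesis xstar_min : minimizers f xstar.

(** On a sphere around xstar outside the given level set, f attains a minimum
f c > f xstar, and by convexity the slope of f seen from xstar is at least as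
large beyond that sphere as on it. The sphere is used, rather than a scaling of
the given level set, since a may be the minimal value itself. *)
Lemma level_sets_bounded a : level_set f a !=set0 ->
  bounded_set (level_set f a) ->
  forall M, exists r, forall x, f x <= M -> `|x| <= r.
Proof.
move=> [x1 x1a] [b [_ /(_ (b + 1))]]; rewrite ltrDl ltr01 => /(_ isT).
move: (b + 1) => r0 Hr0 M.
pose r := `|r0| + `|xstar| + 1.
have r_gt0 : 0 < r by rewrite /r addrC ltr_pwDl // addr_ge0.
pose S := [set z : 'rV[R]_n | `|z - xstar| = r].
have Sa z : S z -> a < f z.
  move=> Sz; rewrite ltNge; apply/negP => /Hr0 /= zr0.
  have := ler_normB z xstar; rewrite Sz /r.
  by have := ler_norm r0; lra.
have xstar_a : f xstar <= a by apply: le_trans x1a; exact: xstar_min.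
have toS x : x != xstar -> S (xstar + (r / `|x - xstar|) *: (x - xstar)).
  rewrite -subr_eq0 -normr_gt0 => d0.
  rewrite /S /= addrC addKr normrZ ger0_norm ?divr_ge0 1?ltW //.
  by rewrite divfK // gt_eqF.
have [[c [Sc cmin]]|noS] :=
  pselect (exists c, S c /\ forall z, S z -> f c <= f z); last first.
  (* the sphere is empty in dimension 0, where xstar is the only point *)
  exists `|xstar| => x _; have [->//|/toS Sx] := eqVneq x xstar.
  have [|||c] := @EVT_min_rV R n f S; first by eexists; exact: Sx.
  - apply: bounded_closed_compact.
      exists (r + `|xstar|); split=> [|q rq z Sz]; first exact: num_real.
      apply: le_trans (ltW rq); rewrite -Sz -{1}(subrK xstar z).
      exact: ler_normD.
    rewrite (_ : S = (fun z => `|z - xstar|) @^-1` [set r]) //.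
    apply: closed_comp => [z _|]; last exact: closed_eq.
    apply: (@cvg_norm _ _ _ (nbhs z)).
    exact: (@cvgB _ _ _ (nbhs z) _ (fun z => z) (fun=> xstar) z xstar
      (@cvg_id _ (nbhs z)) (cvg_cst _)).
  - by apply: continuous_subspaceT; exact: convex_continuous.
  move=> /set_mem Sc cmin; case: noS; exists c; split=> // z Sz.
  by apply: cmin; exact/mem_set.
have fc : f xstar < f c by apply: le_lt_trans xstar_a (Sa _ Sc).
have g0 : 0 < f c - f xstar by rewrite subr_gt0.
exists (`|xstar| + Num.max r (r * (M - f xstar) / (f c - f xstar))) => x xM.
have := ler_normD xstar (x - xstar); rewrite addrC subrK => /le_trans; apply.
rewrite lerD2l le_max; case: (leP `|x - xstar| r) => //= dr.
have d0 : 0 < `|x - xstar| by lra.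
have xxstar : x != xstar by rewrite -subr_eq0 -normr_gt0.
set t := r / `|x - xstar|.
have t0 : 0 <= t by rewrite divr_ge0 // ltW.
have t1 : t <= 1 by rewrite ler_pdivrMr // mul1r ltW.
have := convex_comb f_convex x xstar t0 t1.
have -> : t *: x + (1 - t) *: xstar = xstar + t *: (x - xstar).
  by rewrite scalerBl scale1r scalerBr addrCA.
move=> /(le_trans (cmin _ (toS x xxstar))) H.
have tE : t * `|x - xstar| = r by rewrite divfK // gt_eqF.
rewrite ler_pdivlMr // -tE.
have : t * (f x - f xstar) <= t * (M - f xstar) by rewrite ler_wpM2l // lerD2r.
by nra.
Qed.

(** Test the subgradient inequality one unit away in the direction of g. *)
Lemma subgradients_bounded r : exists2 C, 0 < C &
  forall x g, `|x| <= r -> subdifferential f x g -> enorm g <= C.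
Proof.
have [B HB] := convex_bounded_above f_convex (r + 1).
exists (Num.max 1 (B - f xstar)) => [|x g xr gx]; first by rewrite lt_max ltr01.
have [->|g0] := eqVneq (enorm g) 0; first by rewrite le_max ler01.
have eg : 0 < enorm g by rewrite lt_neqAle eq_sym g0 enorm_ge0.
have := gx (x + (enorm g)^-1 *: g).
rewrite addrC addKr dotZr -sqr_enorm expr2 mulKf // => H.
have : f (x + (enorm g)^-1 *: g) <= B.
  apply: HB; apply: le_trans (ler_normD _ _) _; apply: lerD => //.
  rewrite normrZ normfV ger0_norm ?enorm_ge0 // ler_pdivrMl // mulr1.
  exact: normr_le_enorm.
rewrite addrC in H * => fB; rewrite le_max; apply/orP; right.
by have := xstar_min x; lra.
Qed.

(** Terms along which f tends to its minimum have a cluster point xbar by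
compactness, and f xbar is minimal by continuity; indices of terms ever closer
to xbar are then chosen recursively. *)
Lemma minimizing_subseq (x : nat -> 'rV[R]_n) r :
  (forall k, `|x k| <= r) ->
  (forall e, 0 < e -> forall K, exists2 k, (K <= k)%N & f (x k) < f xstar + e) ->
  exists2 xbar, minimizers f xbar & subseq_limit x xbar.
Proof.
move=> xr small.
have /choice[z Hz] : forall N, exists k,
    (N <= k)%N /\ f (x k) < f xstar + N.+1%:R^-1.
  by move=> N; have [|k ? ?] := small N.+1%:R^-1 _ N; [|exists k].
have comp : compact (closed_ball (0 : 'rV[R]_n) (`|r| + 1)).
  apply: bounded_closed_compact; last exact: closed_ball_closed.
  exists (`|r| + 1); split=> [|q rq y]; first exact: num_real.
  rewrite closed_ballE ?ltr_wpDl // /closed_ball_ /= sub0r normrN => /le_trans.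
  by apply; exact: ltW.
have [|xbar [_ cl]] := comp ((x \o z) @ \oo) _.
  exists 0%N => // N _.
  rewrite /= closed_ballE ?ltr_wpDl // /closed_ball_ /= sub0r normrN.
  by apply: le_trans (xr _) _; have := ler_norm r; lra.
have near e N : 0 < e -> exists2 k, (N <= k)%N &
    `|xbar - x (z k)| < e.
  move=> e0; have [||y []] := cl ((x \o z) @` [set k | (N <= k)%N]) (ball xbar e).
  - by exists N => // k Nk; exists k.
  - exact: nbhsx_ballx.
  by case=> k Nk <-; rewrite -ball_normE; exists k.
have fbar : f xbar = f xstar.
  apply: le_anti; rewrite xstar_min andbT; apply/ler_addgt0Pr => e e0.
  have e20 : 0 < e / 2 by rewrite divr_gt0.
  have := convex_continuous f_convex (x := xbar).
  move=> /(@cvgrPdist_lt _ _ _ (nbhs xbar) _ f (f xbar)) /(_ _ e20).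
  move=> /(@nbhs_normP R _ xbar)[d /= d0 Hd].
  have [N _ HN] : \forall N \near \oo, N.+1%:R^-1 < e / 2 :> R.
    exact: near_infty_natSinv_lt (PosNum e20).
  have [k Nk /Hd /=] := near d N d0.
  have := (Hz k).2; have : k.+1%:R^-1 < e / 2 := HN k Nk.
  rewrite ltr_norml => h1 h2 /andP[_ h3].
  by move: (k.+1%:R^-1) h1 h2 => q h1 h2; lra.
exists xbar => [y|]; first by rewrite fbar.
(* F (i, j) is an index beyond j at which x is within 1 / (i + 1) of xbar *)
have /choice[F HF] : forall p : nat * nat, exists k,
    (p.2 < k)%N /\ `|xbar - x k| < p.1.+1%:R^-1.
  move=> [i j]; have [|k jk kx] := near i.+1%:R^-1 j.+1; first by [].
  by exists (z k); split=> //=; apply: leq_trans jk (Hz k).1.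
pose sg := fix sg i := if i is i'.+1 then F (i, sg i') else F (0%N, 0%N).
have sgx i : `|xbar - x (sg i)| < i.+1%:R^-1.
  by case: i => [|i]; exact: (HF _).2.
exists sg.
  apply/increasing_seqP => i /=; exact: (HF (_, _)).1.
apply/(@cvgrPdist_lt _ 'rV[R]_n) => e e0; near=> i.
apply: lt_trans (sgx i) _; near: i; exact: near_infty_natSinv_lt (PosNum e0).
Unshelve. all: by end_near. Qed.

End Minimizing.

Lemma running_min_cvg {R : realType} (a : nat -> R) (m : R) :
  (forall k, m <= a k) -> (forall e, 0 < e -> exists k, a k < m + e) ->
  (fun k : nat => \big[Num.min/a 0%N]_(i < k.+1) a i) @ \oo --> m.
Proof.
move=> ma small; apply/cvgrPdist_lt => e e0.
have [k ak] := small e e0.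
exists k => // j /= kj.
have mb : m <= \big[Num.min/a 0%N]_(i < j.+1) a i.
  by apply/bigmin_geP; split.
have : \big[Num.min/a 0%N]_(i < j.+1) a i <= a k.
  exact: (@bigmin_le _ R _ _ (Ordinal (kj : (k < j.+1)%N)) (fun i => a i)).
by rewrite ltr_norml => ?; apply/andP; split; lra.
Qed.

(** * Counters and null sequences *)

Definition escapes (u : nat -> nat) :=
  forall N, exists K, forall k, (K <= k)%N -> (N <= u k)%N.

Lemma nondecreasing_escapes (u : nat -> nat) :
  (forall k, (u k <= u k.+1)%N) ->
  (forall K, exists2 k, (K <= k)%N & (u k < u k.+1)%N) -> escapes u.
Proof.
move=> mono inc.
have homo : {homo u : i j / (i <= j)%N}.
  by apply: homo_leq => // i j k; exact: leq_trans.
elim=> [|N [K HK]]; first by exists 0%N.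
have [k Kk uk] := inc K; exists k.+1 => j kj.
by apply: leq_trans (homo _ _ kj); apply: leq_trans uk; rewrite ltnS HK.
Qed.

Lemma cvg0_small {R : realType} (a : nat -> R) : a @ \oo --> 0 ->
  forall e, 0 < e -> exists N, forall i, (N <= i)%N -> a i < e.
Proof.
move=> /cvgrPdist_lt a0 e e0; have [N _ HN] := a0 _ e0.
exists N => i /HN /=; rewrite sub0r normrN; exact/le_lt_trans/ler_norm.
Qed.

Lemma nat_above {R : realType} (x : R) : exists N : nat, x < N%:R.
Proof.
exists (Num.bound `|x|).
exact: le_lt_trans (ler_norm x) (archi_boundP (normr_ge0 x)).
Qed.

(** * One iteration of the method *)

Section Transitions.
Context {R : realType} {n : nat} (f : 'rV[R]_n -> R) (P : csgm_params R).
Implicit Types (v w : csgm_state R n) (A C : R).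

Definition trial v := st_x v - st_lam v *: st_p v.

Definition descends v :=
  f (trial v) <= f (st_x v) - par_theta P * st_lam v * enorm (st_p v) ^+ 2.

(** Distance and function value restarts have the same effect on the direction,
the step size and the counters; they differ only in the next iterate. *)
Definition restarted v w := [/\ st_p w = st_g w,
  st_lam w = par_beta P (st_m v).+1, st_m w = (st_m v).+1,
  st_t w = (st_t v).+1 & st_b w = 0].

Definition continued v w := [/\ Nr (conv_hull [set st_p v; st_g w]) (st_p w),
  st_b w = st_b v + st_lam v * enorm (st_p v) /\ st_b w <= par_d P (st_t v),
  st_m w = st_m v, st_t w = st_t v &
  if descends v then st_lam w = st_lam v /\ st_s w = st_s v
  else st_lam w = par_alpha P (st_s v) * par_beta P (st_m v) /\
       st_s w = (st_s v).+1].

(** The possible outcomes of a pass once the norm of the direction was tested.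
Descent and null steps are told apart only in [continued]. *)
Variant csgm_move v w : Prop :=
| ValueRestart of par_mu P < f (trial v) & st_x w = st_u v & restarted v w
| DistanceRestart of descends v || (f (trial v) <= par_mu P) &
    st_x w = trial v & restarted v w
| Continue of descends v || (f (trial v) <= par_mu P) &
    st_x w = trial v & continued v w.

Lemma csgm_step2_move v w : csgm_step2 f P v w ->
  [/\ csgm_move v w, subdifferential f (st_x w) (st_g w) &
      f (st_u w) <= f (st_u v)].
Proof.
have uE (y : 'rV[R]_n) :
    f (if f y < f (st_u v) then y else st_u v) <= f (st_u v).
  by case: ifP => // /ltW.
case=> g gy; case: ifPn => [desc|ndesc].
  rewrite /csgm_step4; case: ifPn => [_ [g' gy' ->]|bd [p pN ->]]; split=> //=.
  - by apply: DistanceRestart => //; apply/orP; left.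
  - apply: Continue => //; first by apply/orP; left.
    by split=> //=; rewrite ?leNgt // /descends desc.
rewrite /csgm_step3; case: ifPn => [fy|fy [g' gu ->]]; last first.
  by split=> //; apply: ValueRestart => //; rewrite ltNge.
rewrite /csgm_step4; case: ifPn => [_ [g' gy' ->]|bd [p pN ->]]; split=> //=.
- by apply: DistanceRestart => //; apply/orP; right.
- apply: Continue => //; first by apply/orP; right.
  by split=> //=; rewrite ?leNgt // /descends (negbTE ndesc).
Qed.

Lemma csgm_step1_cases w : let v := csgm_step1 P w in
  (v = w /\ par_eta P (st_t w) < enorm (st_p w)) \/
  [/\ enorm (st_p w) <= par_eta P (st_t w), st_p v = st_g w, st_b v = 0 &
      st_t v = (st_t w).+1].
Proof. by rewrite /csgm_step1; case: leP => h; [right|left]. Qed.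

Lemma csgm_step1_same w : let v := csgm_step1 P w in
  st_x v = st_x w /\ st_m v = st_m w.
Proof. by rewrite /csgm_step1; case: ifP. Qed.

Lemma csgm_move_counters v w : csgm_move v w ->
  st_m w = st_m v /\ st_t w = st_t v \/
  [/\ st_m w = (st_m v).+1, st_t w = (st_t v).+1 &
      st_lam w = par_beta P (st_m w)].
Proof.
case=> [_ _ [_ l m t _]|_ _ [_ l m t _]|_ _ [_ _ m t _]].
- by right; rewrite l m.
- by right; rewrite l m.
- by left.
Qed.

Hypothesis P_adm : csgm_admissible P.

Record sound (x0 : 'rV[R]_n) C v : Prop := Sound {
  sound_g : subdifferential f (st_x v) (st_g v);
  sound_u : f (st_u v) <= f x0;
  sound_x : f (st_x v) <= Num.max (f x0) (par_mu P);
  sound_lam : 0 < st_lam v;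
  sound_lam_beta : st_lam v <= par_beta P (st_m v);
  sound_b : 0 <= st_b v;
  sound_b_d : st_b v <= par_d P (st_t v);
  sound_p : enorm (st_p v) <= C }.

(** The inequality satisfied by a convex combination p of subgradients taken at
points within path length b of the current iterate and of value at least A,
when C bounds the norms: each subgradient contributes
A + <g, z - x> - C b <= f z. Stated for p alone, it propagates along the run
without recording the combination. *)
Definition aggregate A C v :=
  forall z, A + dot (st_p v) (z - st_x v) - C * st_b v <= f z.

Lemma aggregate_subgradient A C v : subdifferential f (st_x v) (st_p v) ->
  st_b v = 0 -> A <= f (st_x v) -> aggregate A C v.
Proof. by move=> gx b0 Ax z; have := gx z; rewrite b0; lra. Qed.

Section Invariants.
Context (x0 : 'rV[R]_n) (C : R).
Hypothesis C_ge : forall x g, f x <= Num.max (f x0) (par_mu P) ->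
  subdifferential f x g -> enorm g <= C.

Lemma sound_step1 w : sound x0 C w -> sound x0 C (csgm_step1 P w).
Proof.
move=> sw; rewrite /csgm_step1; case: ifP => _ //.
case: sw => gx ux xM l0 lb b0 bd pC; split=> //=.
- exact: ltW (d_gt0 P_adm _).
- exact: C_ge gx.
Qed.

Lemma sound_move v w : sound x0 C v -> csgm_move v w ->
  subdifferential f (st_x w) (st_g w) -> f (st_u w) <= f (st_u v) ->
  sound x0 C w.
Proof.
case=> gx ux xM l0 lb b0 bd pC mv gw uw.
have uM : f (st_u v) <= Num.max (f x0) (par_mu P) by rewrite le_max ux.
have yM : descends v || (f (trial v) <= par_mu P) ->
    f (trial v) <= Num.max (f x0) (par_mu P).
  case/orP=> [|h]; last by rewrite le_max h orbT.
  rewrite /descends => h; apply: le_trans xM; apply: le_trans h _.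
  have /andP[th0 _] := theta_itv P_adm.
  by rewrite gerBl mulr_ge0 ?sqr_ge0 // mulr_ge0 // ltW.
have rs : f (st_x w) <= Num.max (f x0) (par_mu P) -> restarted v w ->
    sound x0 C w.
  move=> xwM [pE lE mE tE bE]; split=> //.
  - exact: le_trans uw ux.
  - by rewrite lE; exact: beta_gt0.
  - by rewrite lE mE.
  - by rewrite bE.
  - by rewrite bE; exact: ltW (d_gt0 P_adm _).
  - by rewrite pE; exact: C_ge gw.
case: mv => [_ xE|/yM {}yM xE|/yM {}yM xE].
- by apply: rs; rewrite xE.
- by apply: rs; rewrite xE.
case=> [[_ pmin] [bE bd'] mE tE lE]; split=> //.
- exact: le_trans uw ux.
- by rewrite xE.
- case: ifP lE => _ [-> _] //.
  by rewrite mulr_gt0 ?(beta_gt0 P_adm) //; case/andP: (alpha_itv P_adm (st_s v)).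
- rewrite mE; case: ifP lE => _ [-> _] //.
  rewrite ger_pMl ?(beta_gt0 P_adm) // ltW //.
  by case/andP: (alpha_itv P_adm (st_s v)).
- by rewrite bE addr_ge0 // mulr_ge0 ?enorm_ge0 // ltW.
- by rewrite tE.
- by apply: le_trans pC; apply: pmin => B [_ HB]; apply: HB; left.
Qed.

Lemma aggregate_step1 A w : sound x0 C w -> A <= f (st_x w) ->
  aggregate A C w -> aggregate A C (csgm_step1 P w).
Proof.
move=> sw Ax aw; have [xE _] := csgm_step1_same w.
have [[-> _]//|[_ pE bE _]] := csgm_step1_cases w.
apply: aggregate_subgradient; rewrite ?xE ?pE //; exact: sound_g sw.
Qed.

Lemma aggregate_restarted A v w : restarted v w ->
  subdifferential f (st_x w) (st_g w) -> A <= f (st_x w) -> aggregate A C w.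
Proof.
by move=> [pE _ _ _ bE] gw Aw; apply: aggregate_subgradient; rewrite ?pE.
Qed.

(** In the continuing case, moving the base point from x to the trial point
x - lam p costs lam |p|^2 <= C lam |p|, which is C times the increase of b. The
old direction and the new subgradient then satisfy the same affine inequality,
which passes to their hull. *)
Lemma aggregate_move A v w : sound x0 C v -> aggregate A C v ->
  csgm_move v w -> subdifferential f (st_x w) (st_g w) -> A <= f (st_x w) ->
  aggregate A C w.
Proof.
move=> sv av mv gw Aw.
case: mv => [_ _|_ _|_ xE [[pN _] [bE _] _ _ _]];
  [by move/aggregate_restarted; exact..|move=> z].
have C0 : 0 <= C := le_trans (enorm_ge0 _) (sound_p sv).
have b0 : 0 <= st_b w.
  rewrite bE addr_ge0 ?(sound_b sv) // mulr_ge0 ?enorm_ge0 // ltW //.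
  exact: sound_lam sv.
suff : dot (st_p w) (z - st_x w) <= f z - A + C * st_b w by lra.
apply: (conv_hull_dot_le _ _ pN); last first.
  by have := gw z; have := mulr_ge0 C0 b0; lra.
have -> : z - st_x w = (z - st_x v) + st_lam v *: st_p v.
  by rewrite xE /trial opprB addrA addrAC.
rewrite dotDr dotZr -sqr_enorm bE; have := av z.
have : st_lam v * (enorm (st_p v) * enorm (st_p v))
    <= st_lam v * (C * enorm (st_p v)).
  by rewrite ler_pM2l ?(sound_lam sv) // ler_wpM2r ?enorm_ge0 // (sound_p sv).
by nra.
Qed.

(** With z = xstar, [aggregate] says that <p, x - xstar> >= e - C b >= e / 2,
so the squared distance decreases at rate at least e along -p. The quadratic
term lam^2 |p|^2 is absorbed because lam <= beta_m is small. *)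
Lemma trial_closer xstar e v : sound x0 C v -> aggregate (f xstar + e) C v ->
  C * par_d P (st_t v) <= e / 2 -> par_beta P (st_m v) * C ^+ 2 <= e / 2 ->
  enorm (trial v - xstar) ^+ 2
    <= enorm (st_x v - xstar) ^+ 2 - st_lam v * (e / 2).
Proof.
move=> sv av Cd bC.
have C0 : 0 <= C := le_trans (enorm_ge0 _) (sound_p sv).
have l0 := sound_lam sv.
have Cb : C * st_b v <= C * par_d P (st_t v).
  by rewrite ler_wpM2l // (sound_b_d sv).
have pC : enorm (st_p v) ^+ 2 <= C ^+ 2.
  by rewrite ler_pXn2r ?nnegrE ?enorm_ge0 // (sound_p sv).
have lC : st_lam v * enorm (st_p v) ^+ 2 <= e / 2.
  apply: le_trans bC; apply: ler_pM => //;
    [exact: ltW|exact: sqr_ge0|exact: sound_lam_beta sv].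
have := av xstar; rewrite -(opprB (st_x v)) dotNr => H.
have {}H : e / 2 <= dot (st_p v) (st_x v - xstar) by lra.
have -> : trial v - xstar = (st_x v - xstar) - st_lam v *: st_p v.
  by rewrite /trial addrAC.
move: H lC; rewrite !sqr_enorm; move: (st_x v - xstar) => q H lC.
rewrite !dotE (dotC q (st_p v)).
have : st_lam v * (e / 2) <= st_lam v * dot (st_p v) q by rewrite ler_pM2l.
have : st_lam v * (st_lam v * dot (st_p v) (st_p v)) <= st_lam v * (e / 2).
  by rewrite ler_pM2l.
by lra.
Qed.

(** With z = xstar, [aggregate] gives e <= <p, x - xstar> + C b, and a norm
restart would make the right-hand side at most eta_t D + C d_t. *)
Lemma no_norm_restart xstar e D w : sound x0 C w -> aggregate (f xstar + e) C w ->
  enorm (st_x w - xstar) <= D ->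
  par_eta P (st_t w) * D + C * par_d P (st_t w) < e -> csgm_step1 P w = w.
Proof.
move=> sw aw xD small.
have [[]//|[p_eta _ _ _]] := csgm_step1_cases w.
have C0 : 0 <= C := le_trans (enorm_ge0 _) (sound_p sw).
have Cb : C * st_b w <= C * par_d P (st_t w).
  by rewrite ler_wpM2l // (sound_b_d sw).
exfalso; have := aw xstar; rewrite -(opprB (st_x w)) dotNr.
have := dot_le_enormM (st_p w) (st_x w - xstar).
have : enorm (st_p w) * enorm (st_x w - xstar) <= par_eta P (st_t w) * D.
  by apply: ler_pM; rewrite ?enorm_ge0.
by lra.
Qed.

(** A lower bound on the decrease of |p|^2 in [Nr_decrease] while |p| > eta. *)
Definition null_gain C eta : R :=
  ((1 - par_theta P) / (2 * C)) ^+ 2 * (eta ^+ 2) ^+ 2.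

(** A null step has <g, p> <= th |p|^2 for the new subgradient g, because f at
the trial point is too large for the segment back to x to be steep. So
[Nr_decrease] applies, and as st_s counts the null steps, the quantity below
does not increase. *)
Lemma continued_potential v w eta : 0 < C -> 0 < eta -> eta < enorm (st_p v) ->
  sound x0 C v -> sound x0 C w -> st_x w = trial v -> continued v w ->
  enorm (st_p w) ^+ 2 + null_gain C eta * (st_s w)%:R <=
  enorm (st_p v) ^+ 2 + null_gain C eta * (st_s v)%:R.
Proof.
move=> C_gt0 eta0 p_eta sv sw xE [pN _ _ _].
case: ifPn => [_ [_ ->]|nd [_ ->]].
  rewrite lerD2r ler_pXn2r ?nnegrE ?enorm_ge0 //; case: pN => _; apply.
  by move=> B [_ HB]; apply: HB; left.
have gp : dot (st_g w) (st_p v) <= par_theta P * enorm (st_p v) ^+ 2.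
  have := sound_g sw (st_x v); rewrite xE.
  move: nd; rewrite /descends -ltNge => nd.
  rewrite /trial opprB addrC subrK dotZr => Hg.
  have l0 := sound_lam sv.
  by rewrite -(ler_pM2l l0); move: nd Hg; rewrite /trial; lra.
have := Nr_decrease (theta_itv P_adm) C_gt0 (sound_p sv) _ gp pN.
move=> /(_ (C_ge (sound_x sw) (sound_g sw))).
have : null_gain C eta <=
    ((1 - par_theta P) / (2 * C)) ^+ 2 * (enorm (st_p v) ^+ 2) ^+ 2.
  rewrite /null_gain ler_wpM2l ?sqr_ge0 // ler_pXn2r ?nnegrE ?sqr_ge0 //.
  by rewrite ler_pXn2r ?nnegrE ?enorm_ge0 ?(ltW eta0) // ltW.
by rewrite -[(st_s v).+1]addn1 natrD mulrDr mulr1; lra.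
Qed.

End Invariants.
End Transitions.

(** * Restarts occur forever *)

Section Run.
Context {R : realType} {n : nat} (f : 'rV[R]_n -> R) (P : csgm_params R).
Hypothesis P_adm : csgm_admissible P.
Context (x0 : 'rV[R]_n) (w : nat -> csgm_state R n) (C : R).
Hypothesis w0 : csgm_step0 f P x0 (w 0%N).
Hypothesis wS : forall k, csgm_step2 f P (csgm_step1 P (w k)) (w k.+1).
Hypothesis C_gt0 : 0 < C.
Hypothesis C_ge : forall x g, f x <= Num.max (f x0) (par_mu P) ->
  subdifferential f x g -> enorm g <= C.

Let v k := csgm_step1 P (w k).

Lemma run_sound k : sound f P x0 C (w k).
Proof.
elim: k => [|k IHk].
  have [g0 g0x ->] := w0; split=> //=; rewrite ?le_max ?lexx //.
  - exact: beta_gt0.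
  - exact: ltW (d_gt0 P_adm _).
  - by apply: C_ge g0x; rewrite le_max lexx.
have [mv gx ux] := csgm_step2_move (wS k).
by apply: (sound_move P_adm C_ge _ mv gx ux); exact: (sound_step1 P_adm C_ge).
Qed.

Lemma run_move k : csgm_move f P (v k) (w k.+1).
Proof. by have [] := csgm_step2_move (wS k). Qed.

Lemma run_t_nondecreasing k : (st_t (w k) <= st_t (v k) <= st_t (w k.+1))%N.
Proof.
apply/andP; split.
  by rewrite /v; have [[-> _]|[_ _ _ ->]] := csgm_step1_cases P (w k).
by have [[_ ->]|[_ -> _]] := csgm_move_counters (run_move k).
Qed.

(** Otherwise, from iteration K on, all steps continue one cycle and
|p| > eta. The potential of [continued_potential] bounds the number of null
steps, so from iteration K + I on the step size is a constant lam and b grows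
by more than lam eta at each step, beyond d_t. *)
Lemma restarts_forever : escapes (fun k => st_t (w k)).
Proof.
apply: nondecreasing_escapes => [k|K].
  by have /andP[] := run_t_nondecreasing k; exact: leq_trans.
apply: contrapT => H.
have tS k : (K <= k)%N -> st_t (w k.+1) = st_t (w k).
  move=> Kk; apply/eqP; rewrite eqn_leq; apply/andP; split.
    by rewrite leqNgt; apply/negP => ?; apply: H; exists k.
  by have /andP[] := run_t_nondecreasing k; exact: leq_trans.
have tE i : st_t (w (K + i)%N) = st_t (w K).
  by elim: i => [|i IHi]; rewrite ?addn0 // addnS tS ?leq_addr.
have vE k : (K <= k)%N -> v k = w k /\ par_eta P (st_t (w k)) < enorm (st_p (w k)).
  move=> Kk; have [//|[_ _ _ tv]] := csgm_step1_cases P (w k).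
  have /andP[_] := run_t_nondecreasing k.
  by rewrite tS // /v tv ltnn.
have cont k : (K <= k)%N ->
    st_x (w k.+1) = trial (w k) /\ continued f P (w k) (w k.+1).
  move=> Kk; have := run_move k; rewrite (vE k Kk).1.
  by case=> [_ _ [_ _ _ + _]|_ _ [_ _ _ + _]|//]; rewrite tS // => /n_Sn.
pose eta := par_eta P (st_t (w K)).
have eta0 : 0 < eta by exact: eta_gt0.
have p_eta i : eta < enorm (st_p (w (K + i)%N)).
  by have [_] := vE (K + i)%N (leq_addr _ _); rewrite tE.
pose c := null_gain P C eta.
have c0 : 0 < c.
  rewrite /c /null_gain mulr_gt0 ?exprn_gt0 // divr_gt0 ?mulr_gt0 // subr_gt0.
  by case/andP: (theta_itv P_adm).
have s_mono i : (st_s (w (K + i)) <= st_s (w (K + i.+1)))%N.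
  have [_ [_ _ _ _]] := cont (K + i)%N (leq_addr _ _).
  by rewrite addnS; case: ifP => _ [_ ->].
have potential i : enorm (st_p (w (K + i)%N)) ^+ 2 + c * (st_s (w (K + i)%N))%:R
    <= enorm (st_p (w K)) ^+ 2 + c * (st_s (w K))%:R.
  elim: i => [|i]; first by rewrite addn0.
  apply: le_trans; rewrite addnS; have [xE ck] := cont (K + i)%N (leq_addr _ _).
  by have := continued_potential P_adm C_ge C_gt0 eta0 (p_eta i)
    (run_sound _) (run_sound _) xE ck.
have [I HI] : exists I, forall i, (I <= i)%N ->
    st_s (w (K + i.+1)%N) = st_s (w (K + i)%N).
  apply: contrapT => noI.
  have sesc := nondecreasing_escapes s_mono.
  pose B := enorm (st_p (w K)) ^+ 2 + c * (st_s (w K))%:R.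
  have [N BN] := nat_above (B / c).
  have [i|I /(_ I (leqnn _)) sI] := sesc _ N.
    apply: contrapT => H'; apply: noI; exists i => j ij.
    apply/eqP; rewrite eqn_leq s_mono andbT leqNgt; apply/negP => ?.
    by apply: H'; exists j.
  have : B / c < (st_s (w (K + I)%N))%:R.
    by apply: lt_le_trans BN _; rewrite ler_nat.
  rewrite ltr_pdivrMr // ltNge => /negP; apply.
  apply: le_trans (potential I).
  by rewrite mulrC lerDr sqr_ge0.
pose J i := (K + (I + i))%N.
have lamE i : st_lam (w (J i)) = st_lam (w (J 0%N)).
  elim: i => [//|i <-]; rewrite /J !addnS.
  have [_ [_ _ _ _]] := cont (J i) (leq_addr _ _).
  have := HI (I + i)%N (leq_addr _ _); rewrite /J addnS => ->.
  by case: ifP => _ [-> //] /n_Sn.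
have l0 : 0 < st_lam (w (J 0%N)) := sound_lam (run_sound _).
have bJ i : i%:R * (st_lam (w (J 0%N)) * eta) <= st_b (w (J i)).
  elim: i => [|i IHi]; first by rewrite mul0r (sound_b (run_sound _)).
  have [_ [_ [bE _] _ _ _]] := cont (J i) (leq_addr _ _).
  rewrite [in leRHS]/J !addnS bE -natr1 mulrDl mul1r lerD // lamE.
  by rewrite ler_pM2l // ltW // p_eta.
have [N HN] := nat_above (par_d P (st_t (w K)) / (st_lam (w (J 0%N)) * eta)).
have := bJ N; have := sound_b_d (run_sound (J N)).
rewrite tE => h1 /le_trans /(_ h1); rewrite -ler_pdivlMr ?mulr_gt0 //.
by rewrite leNgt HN.
Qed.

(** * The values approach the minimum *)

Context (xstar : 'rV[R]_n) (D rho : R).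
Hypothesis D_ge : forall x, f x <= Num.max (f x0) (par_mu P) ->
  enorm (x - xstar) <= D.
Hypothesis rho_ge : forall x, f x <= f x0 -> enorm (x - xstar) <= rho.
Hypothesis mu_ge : forall x, enorm (x - xstar) <= rho -> f x <= par_mu P.

(** The lemmas of this section hold under an assumption refuted at the end: the
values stay away from the minimum. *)
Section HighValues.
Context (e : R) (K : nat).
Hypothesis e_gt0 : 0 < e.
Hypothesis high : forall k, (K <= k)%N -> f xstar + e <= f (st_x (w k)).

Let sqdist k := enorm (st_x (w k) - xstar) ^+ 2.

Let half_e_gt0 : 0 < e / 2.
Proof. by rewrite divr_gt0. Qed.

(** Only cycles that begin after iteration K consist of points of value at least
f xstar + e; a larger restart counter st_t shows that the cycle is one of
them. *)
Lemma high_aggregate k : (K <= k)%N -> (st_t (w K) < st_t (w k))%N ->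
  aggregate f (f xstar + e) C (w k).
Proof.
move=> /subnKC <-; elim: (k - K)%N => [|i IHi]; first by rewrite addn0 ltnn.
have := high (leq_addr i.+1 K); rewrite addnS.
have := high (leq_addr i K); move: IHi; set j := (K + i)%N => IHj hj hj1 tj.
have [mv gx _] := csgm_step2_move (wS j).
have sj := run_sound j; have sv := sound_step1 P_adm C_ge sj.
have [tK|tK] := ltnP (st_t (w K)) (st_t (w j)).
  exact: (aggregate_move sv (aggregate_step1 sj hj (IHj tK)) mv gx hj1).
have [[vE _]|[_ pE bE tE]] := csgm_step1_cases P (w j).
  move: mv; rewrite vE => -[_ _ rs|_ _ rs|_ _ [_ _ _ tE _]].
  - exact: aggregate_restarted rs gx hj1.
  - exact: aggregate_restarted rs gx hj1.
  - by move: (leq_trans tj (eq_leq tE)); rewrite ltnNge tK.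
apply: (aggregate_move sv _ mv gx hj1).
have [xE _] := csgm_step1_same P (w j).
by apply: aggregate_subgradient; rewrite ?xE ?pE //; exact: sound_g sj.
Qed.

Lemma eventually_no_norm_restart : exists K1, forall k, (K1 <= k)%N ->
  [/\ aggregate f (f xstar + e) C (w k), v k = w k &
      C * par_d P (st_t (w k)) <= e / 2].
Proof.
have D0 : 0 < `|D| + 1 by rewrite ltr_pwDr.
have [N1 HN1] := cvg0_small (eta_cvg P_adm) (divr_gt0 half_e_gt0 D0).
have [N2 HN2] := cvg0_small (d_cvg P_adm) (divr_gt0 half_e_gt0 C_gt0).
have [K0 HK0] := restarts_forever (maxn (st_t (w K)).+1 (maxn N1 N2)).
exists (maxn K K0) => k.
rewrite geq_max => /andP[Kk /HK0]; rewrite !geq_max => /and3P[tk t1 t2].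
have ak := high_aggregate Kk tk.
have dk : C * par_d P (st_t (w k)) < e / 2.
  by rewrite mulrC -ltr_pdivlMr // HN2.
split=> //; last exact: ltW.
apply: (no_norm_restart (run_sound k) ak (D_ge (sound_x (run_sound k)))).
have := HN1 _ t1; rewrite ltr_pdivlMr // => ek.
have := eta_gt0 P_adm (st_t (w k)); have := ler_norm D => D1 eta0.
have : par_eta P (st_t (w k)) * D <= par_eta P (st_t (w k)) * (`|D| + 1).
  by rewrite ler_wpM2l ?ltW //; lra.
by lra.
Qed.

(** Without norm restarts, the counters m and t advance together. *)
Lemma beta_advances_forever : escapes (fun k => st_m (w k)).
Proof.
have [K1 late] := eventually_no_norm_restart.
apply: nondecreasing_escapes => [k|I].
  have [_ mE] := csgm_step1_same P (w k).
  by have [[-> _]|[-> _ _]] := csgm_move_counters (run_move k); rewrite /v mE.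
apply: contrapT => noI; pose J := maxn K1 I.
have tE i : st_t (w (J + i)%N) = st_t (w J).
  elim: i => [|i <-]; first by rewrite addn0.
  have : (J <= J + i)%N by exact: leq_addr.
  rewrite addnS geq_max => /andP[/late[_ vE _] Ii].
  have := csgm_move_counters (run_move (J + i)%N); rewrite vE.
  by move=> [[_ ->]//|[mS _ _]]; case: noI; exists (J + i)%N; rewrite ?mS.
have [L HL] := restarts_forever (st_t (w J)).+1.
by have := HL (J + L)%N (leq_addl _ _); rewrite tE ltnn.
Qed.

Lemma eventually_closer : exists K2, forall k, (K2 <= k)%N ->
  csgm_move f P (w k) (w k.+1) /\
  enorm (trial (w k) - xstar) ^+ 2 <= sqdist k - st_lam (w k) * (e / 2).
Proof.
have [K1 late] := eventually_no_norm_restart.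
have C20 : 0 < C ^+ 2 by rewrite exprn_gt0.
have [N HN] := cvg0_small (beta_cvg P_adm) (divr_gt0 half_e_gt0 C20).
have [I HI] := beta_advances_forever N.
exists (maxn K1 I) => k; rewrite geq_max => /andP[/late[ak vE dk] /HI mk].
split; first by have := run_move k; rewrite vE.
apply: (trial_closer (run_sound k) ak dk).
by rewrite -ler_pdivlMr // ltW // HN.
Qed.

Let decrease_gt0 k : 0 < st_lam (w k) * (e / 2).
Proof. by rewrite mulr_gt0 // (sound_lam (run_sound k)). Qed.

(** A value restart returns to a record point, whose value is at most f x0 and
whose distance to xstar is therefore at most rho. Within that ball the trial
points have value at most mu and, by [eventually_closer], stay in the ball. So
at most one value restart is still to come. *)
Lemma eventually_no_value_restart : exists K3, forall k, (K3 <= k)%N ->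
  csgm_move f P (w k) (w k.+1) /\
  sqdist k.+1 <= sqdist k - st_lam (w k) * (e / 2).
Proof.
have [K2 near] := eventually_closer.
suff [K3 K23 noval] : exists2 K3, (K2 <= K3)%N &
    forall k, (K3 <= k)%N -> st_x (w k.+1) = trial (w k).
  exists K3 => k K3k; have [mv closer] := near k (leq_trans K23 K3k).
  by split=> //; rewrite {1}/sqdist noval.
have rho0 : 0 <= rho := le_trans (enorm_ge0 _) (rho_ge (lexx _)).
have in_ball k : (K2 <= k)%N -> sqdist k <= rho ^+ 2 ->
    st_x (w k.+1) = trial (w k).
  move=> /near[mv closer] dk; have fy : f (trial (w k)) <= par_mu P.
    apply: mu_ge; rewrite -(@ler_pXn2r _ 2) ?nnegrE ?enorm_ge0 //.
    by have := decrease_gt0 k; lra.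
  by case: mv => [mu_lt _ _|_ xE _|_ xE _] //; move: mu_lt; rewrite ltNge fy.
have [[k K2k xu]|no] := pselect (exists2 k, (K2 <= k)%N &
    st_x (w k.+1) = st_u (w k)); last first.
  exists K2 => // k K2k.
  have [mv _] := near k K2k; case: mv => [_ xE _|_ xE _|_ xE _] //.
  by case: no; exists k.
exists k.+1; first exact: leq_trans K2k (leqnSn _).
suff dk i : sqdist (k.+1 + i)%N <= rho ^+ 2.
  move=> j kj; apply: in_ball; first exact: leq_trans K2k (ltnW kj).
  by rewrite -(subnKC kj).
elim: i => [|i IHi].
  rewrite addn0 /sqdist xu ler_pXn2r ?nnegrE ?enorm_ge0 //.
  exact: rho_ge (sound_u (run_sound k)).
have K2i : (K2 <= k.+1 + i)%N.
  by apply: leq_trans K2k _; rewrite addSnnS leq_addr.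
have [_ closer] := near _ K2i.
rewrite addnS {1}/sqdist (in_ball _ K2i IHi); apply: le_trans closer _.
by have := decrease_gt0 (k.+1 + i)%N; lra.
Qed.

(** The squared distance to xstar decreases by at least beta_m e / 2 at the
first step after each restart, which exhausts it since the sum of the beta_m
diverges. *)
Lemma high_values_absurd : False.
Proof.
have [K3 late] := eventually_no_value_restart.
pose S m := \sum_(0 <= j < m) par_beta P j.
have SE m : S m.+1 = S m + par_beta P m by rewrite /S big_nat_recr.
(* The bound is read just after a step: the step size of the first step after a
   restart is then already accounted for. The cycle containing K3 may have
   begun earlier, hence the sum starts with the next one. *)
have decr i : sqdist (K3 + i).+1 <=
    sqdist K3 - e / 2 * (S (st_m (w (K3 + i)%N)).+1 - S (st_m (w K3)).+1).
  elim: i => [|i IHi].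
    have [_] := late K3 (leqnn _); have := decrease_gt0 K3.
    by rewrite addn0 subrr mulr0; lra.
  have [mv _] := late (K3 + i)%N (leq_addr _ _).
  have [_] := late (K3 + i.+1)%N (leq_addr _ _).
  have := decrease_gt0 (K3 + i.+1)%N; rewrite addnS.
  case: (csgm_move_counters mv) => [[mE _]|[mE _ lE]].
    by rewrite mE; lra.
  by rewrite lE mE SE => l0 H0; apply: le_trans H0 _; lra.
have [N _ HN] := (cvgryPge _).1 (beta_dvg P_adm)
  (sqdist K3 / (e / 2) + S (st_m (w K3)).+1 + 1).
have [I HI] := beta_advances_forever N.
have := decr I.
have : 0 <= sqdist (K3 + I).+1 by rewrite sqr_ge0.
have : sqdist K3 / (e / 2) + S (st_m (w K3)).+1 + 1 <= S (st_m (w (K3 + I)%N)).+1.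
  by apply: HN; apply: leq_trans (leqnSn _); apply: HI; exact: leq_addl.
set Y := S (st_m (w K3)).+1; set X := S _ => YX V0 H1.
have : e / 2 * (sqdist K3 / (e / 2)) = sqdist K3.
  by rewrite mulrC divfK // gt_eqF.
move: (sqdist K3 / (e / 2)) YX => q YX qE.
have : e / 2 * (q + Y + 1) <= e / 2 * X by rewrite ler_pM2l.
by move: half_e_gt0; lra.
Qed.

End HighValues.

Lemma run_small_values e K : 0 < e ->
  exists2 k, (K <= k)%N & f (st_x (w k)) < f xstar + e.
Proof.
move=> e0; apply: contrapT => H; apply: (@high_values_absurd e K e0) => k Kk.
by rewrite leNgt; apply/negP => ?; apply: H; exists k.
Qed.

End Run.

Theorem theorem1 (R : realType) (n : nat) (f : 'rV[R]_n -> R)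
  (f_convex : convex_function [set: 'rV[R]_n] f)
  (f_level : exists a : R,
      level_set f a !=set0 /\ bounded_set (level_set f a))
  (fstar : R) (fstar_min : least (range f) fstar)
  (x0 xstar : 'rV[R]_n) (xstar_min : minimizers f xstar)
  (rho' : R)
  (rho'_radius :
    least [set r | 0 <= r /\ level_set f (f x0) `<=` ecball xstar r] rho')
  (mu' : R) (mu'_level : ecball xstar rho' `<=` level_set f mu')
  (P : csgm_params R) (P_adm : csgm_admissible P) (P_mu : mu' <= par_mu P)
  (x : nat -> 'rV[R]_n) (x_csgm : csgm_sequence f P x0 x) :
  (exists2 xbar, minimizers f xbar & subseq_limit x xbar) /\
  (fun k : nat => \big[Num.min/f (x 0%N)]_(i < k.+1) f (x i)) @ \oo --> fstar.
Proof.
have fstarE : fstar = f xstar.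
  have [[z _ <-] lb] := fstar_min.
  by apply: le_anti; rewrite xstar_min lb //; exists xstar.
have [a [a0 a_bnd]] := f_level.
have [r Hr] := level_sets_bounded f_convex xstar_min a0 a_bnd
  (Num.max (f x0) (par_mu P)).
have [C C_gt0 HC] := subgradients_bounded f_convex xstar_min r.
have [w [w0 wS xE]] := x_csgm.
have C_ge y g : f y <= Num.max (f x0) (par_mu P) -> subdifferential f y g ->
    enorm g <= C by move=> /Hr; exact: HC.
have D_ge y : f y <= Num.max (f x0) (par_mu P) ->
    enorm (y - xstar) <= Num.sqrt n%:R * (r + `|xstar|).
  move=> /Hr yr; apply: le_trans (enorm_le_normr _) _.
  rewrite ler_wpM2l ?sqrtr_ge0 //; apply: le_trans (ler_normB _ _) _.
  by rewrite lerD2r.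
have rho_ge y : f y <= f x0 -> enorm (y - xstar) <= rho'.
  have [[_ sub] _] := rho'_radius.
  by move=> /sub; rewrite /ecball /closed_ball_ /= enormB.
have mu_ge y : enorm (y - xstar) <= rho' -> f y <= par_mu P.
  move=> yr; apply: le_trans P_mu; apply: mu'_level.
  by rewrite /ecball /closed_ball_ /= enormB.
have small e : 0 < e -> forall K, exists2 k, (K <= k)%N & f (x k) < f xstar + e.
  move=> e0 K.
  have [k Kk fk] :=
    run_small_values P_adm w0 wS C_gt0 C_ge D_ge rho_ge mu_ge K e0.
  by exists k => //; rewrite xE.
have x_bnd k : `|x k| <= r.
  by rewrite xE; exact: Hr (sound_x (run_sound P_adm w0 wS C_ge k)).
split; first exact: (minimizing_subseq f_convex xstar_min x_bnd small).
rewrite fstarE.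
apply: (@running_min_cvg R (f \o x)) => [k|e /small/(_ 0%N)[k _ fk]].
  exact: xstar_min.
by exists k.
Qed.
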